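(* Let $i\in I^{im}$. For all integers $k,l>0$ the following commutation relation holds in the quantum Borcherds-Bozec algebra $U_q(\mathfrak g)$: $$e_{il}f_{ik}-f_{ik}e_{il}=\sum_{p=1}^{\min\{k,l\}}\left\{\sum_{r=1}^{p}\left[\nu_{ir}\,\vartheta_{i,p-r}\,(q_{(i)}^{k-l}K_i)^{r-p}\left((q_{(i)}^{k-l}K_i)^{r}-(q_{(i)}^{k-l}K_i)^{-r}\right)\right]\right\}f_{i,k-p}\,e_{i,l-p},$$ where $\vartheta_{i,m}=\sum_{\mathbf c\in\mathcal C_m}(-1)^{\|\mathbf c\|}\nu_{i\mathbf c}$.
   Context: **Cartan datum.** $I$ is a countable (possibly infinite) index set; $A=(a_{ij})_{i,j\in I}$ is an integer matrix with $a_{ii}\in\{2,0,-2,-4,\dots\}$, $a_{ij}\le 0$ for $i\ne j$, and there are positive integers $r_i$ with $r_ia_{ij}=r_ja_{ji}$. $I^{re}=\{i:a_{ii}=2\}$, $I^{im}=\{i:a_{ii}\le0\}$, $I^\infty=(I^{re}\times\{1\})\cup(I^{im}\times\mathbb Z_{>0})$; for $i\in I^{re}$ write $i$ for $(i,1)$. $P^\vee$ is the free abelian group with basis $\{h_i,d_i: i\in I\}$, $\mathfrak h=\mathbb Q\otimes_{\mathbb Z}P^\vee$. The simple roots $\alpha_i\in\mathfrak h^*$ satisfy $\alpha_j(h_i)=a_{ij}$, $\alpha_j(d_i)=\delta_{ij}$. $(\ ,\ )$ is the symmetric bilinear form with $(\alpha_i,\lambda)=r_i\lambda(h_i)$, so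 $(\alpha_i,\alpha_j)=r_ia_{ij}$. **Quantum Borcherds-Bozec algebra.** $q$ is an indeterminate, $q_i=q^{r_i}$, $q_{(i)}=q^{(\alpha_i,\alpha_i)/2}$; for $i\in I^{re}$, $[n]_i=\frac{q_i^n-q_i^{-n}}{q_i-q_i^{-1}}$, with the associated $q$-factorials $[n]_i!$ and $q$-binomials. $\mathscr F$ is the free associative $\mathbb Q(q)$-algebra on $f_{il}$ $((i,l)\in I^\infty)$, graded by $|f_{il}|=-l\alpha_i$, and $\mathscr F\otimes\mathscr F$ has the twisted product $(x_1\otimes x_2)(y_1\otimes y_2)=q^{-(|x_2|,|y_1|)}x_1y_1\otimes x_2y_2$; $\delta:\mathscr F\to\mathscr F\otimes\mathscr F$ is the algebra map $\delta(f_{il})=\sum_{m+n=l}q_{(i)}^{-mn}f_{im}\otimes f_{in}$ (with $f_{i0}=1$; likewise $e_{i0}=1$ below). Fix nonzero $\nu_{il}\in\mathbb Q(q)$ with $\nu_{il}\in1+q\mathbb Z_{\ge0}[[q]]$. $(\ ,\ )_L$ is the symmetric bilinear form on $\mathscr F$ with $(x,y)_L=0$ if $|x|\ne|y|$, $(1,1)_L=1$, $(f_{il},f_{il})_L=\nu_{il}$, $(x,yz)_L=(\delta(x),y\otimes z)_L$. $\widehat U$ is the $\mathbb Q(q)$-algebra generated by $q^h$ $(h\in P^\vee)$, $e_{il},f_{il}$ $((i,l)\in I^\infty)$ with relations $q^0=1$, $q^hq^{h'}=q^{h+h'}$, $q^he_{jl}q^{-h}=q^{l\alpha_j(h)}e_{jl}$,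 $q^hf_{jl}q^{-h}=q^{-l\alpha_j(h)}f_{jl}$; $\sum_{k=0}^{1-la_{ij}}(-1)^k\begin{bmatrix}1-la_{ij}\\k\end{bmatrix}_ix_i^{1-la_{ij}-k}x_{jl}x_i^k=0$ for $x=e$ and $x=f$, $i\in I^{re}$, $i\ne(j,l)$; $[e_{ik},e_{jl}]=[f_{ik},f_{jl}]=0$ if $a_{ij}=0$. With $K_i=q_i^{h_i}=q^{r_ih_i}$, its comultiplication is $\Delta(q^h)=q^h\otimes q^h$, $\Delta(e_{il})=\sum_{m+n=l}q_{(i)}^{mn}e_{im}\otimes K_i^{-m}e_{in}$, $\Delta(f_{il})=\sum_{m+n=l}q_{(i)}^{-mn}f_{im}K_i^n\otimes f_{in}$. $\omega$ is the involution $q^h\mapsto q^{-h}$, $e_{il}\leftrightarrow f_{il}$. The form $(\ ,\ )_L$ extends to $\widehat U$ (Bozec) with $(q^h,1)_L=1$, $(q^h,f_{il})_L=0$, $(q^h,K_j)_L=q^{-\alpha_j(h)}$, $(x,y)_L=(\omega(x),\omega(y))_L$ for $x,y$ in the subalgebra $\widehat U^+$ generated by the $e_{il}$, and on the subalgebra $\widehat U^{\le0}$ generated by the $f_{il},q^h$ it is compatible with $\Delta$: $(x,yz)_L=(\Delta(x),y\otimes z)_L$. $\widetilde U$ is the quotient of $\widehat U$ by the relations (Sweedler notation) $\sum(a_{(1)},b_{(2)})_L\,\omega(b_{(1)})a_{(2)}=\sum(a_{(2)},b_{(1)})_L\,a_{(1)}\omega(b_{(2)})$ for $a,b\in\widehat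 U^{\le0}$. The quantum Borcherds-Bozec algebra $U_q(\mathfrak g)$ is the quotient of $\widetilde U$ by the radical of $(\ ,\ )_L$ restricted to $\widetilde U^-\times\widetilde U^+$, where $\widetilde U^-$ and $\widetilde U^+$ are the subalgebras generated by the $f_{il}$ and the $e_{il}$. **Compositions.** $\mathcal C_m$ is the set of compositions $\mathbf c=(c_1,\dots,c_d)$ of $m$ (ordered tuples of positive integers with sum $m$), $\|\mathbf c\|=d$, and $\nu_{i\mathbf c}=\prod_{j=1}^d\nu_{ic_j}$. For $m=0$ the only composition is the empty one, so $\vartheta_{i,0}=1$. *)

(* Defs.v *)
From HB Require Import structures.
From mathcomp Require Import all_boot all_order all_algebra.
From mathcomp Require Import finmap boolp.
From mathcomp.multinomials Require Import monalg.

Set Implicit Arguments.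
Unset Strict Implicit.
Unset Printing Implicit Defensive.

Import GRing.Theory Num.Theory.

Local Open Scope ring_scope.
Local Open Scope quotient_scope.

(* Associative unital algebras over a field, 1 = 0 not being excluded.
   MathComp's lalgType and algType require 1 != 0, which is not available for
   an algebra presented by generators and relations, and its hierarchy has no
   room for a join of pzRingType and lmodType below them; hence the separate
   scaling operation, written c **: x. *)
HB.mixin Record PzRing_isPzAlg (K : fieldType) A of GRing.PzRing A := {
  ascale : K -> A -> A;
  ascaleA : forall (b c : K) (x : A),
    ascale b (ascale c x) = ascale (b * c) x;
  ascale1 : forall x : A, ascale 1 x = x;
  ascaleDr : forall (c : K) (x y : A),
    ascale c (x + y) = ascale c x + ascale c y;
  ascaleDl : forall (b c : K) (x : A),
    ascale (b + c) x = ascale b x + ascale c x;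
  ascaleAl : forall (c : K) (x y : A), ascale c (x * y) = ascale c x * y;
  ascaleAr : forall (c : K) (x y : A), ascale c (x * y) = x * ascale c y
}.

#[short(type="pzAlgType")]
HB.structure Definition PzAlg (K : fieldType) :=
  {A of GRing.PzRing A & PzRing_isPzAlg K A}.

Reserved Notation "c **: x" (at level 40, left associativity).
Notation "c **: x" := (ascale c x) : ring_scope.

(* The same vector space as an object of MathComp's lmodType K. *)
Definition lmod_of (K : fieldType) (A : pzAlgType K) : Type := A.
HB.instance Definition _ (K : fieldType) (A : pzAlgType K) :=
  GRing.Zmodule.on (lmod_of A).
HB.instance Definition _ (K : fieldType) (A : pzAlgType K) :=
  @GRing.Zmodule_isLmodule.Build K (lmod_of A) (@ascale K A)
    (@ascaleA K A) (@ascale1 K A) (@ascaleDr K A)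
    (fun x b c => @ascaleDl K A b c x).

Section PzAlgTheory.
Context (K : fieldType) (A : pzAlgType K).
Implicit Types (c : K) (x y : A).

Lemma ascaler0 c : c **: (0 : A) = 0.
Proof. exact: (@scaler0 K (lmod_of A)). Qed.
Lemma ascaleNr c x : c **: (- x) = - (c **: x).
Proof. exact: (@scalerN K (lmod_of A)). Qed.
Lemma ascaleBr c x y : c **: (x - y) = c **: x - c **: y.
Proof. exact: (@scalerBr K (lmod_of A)). Qed.
Lemma ascaleN1 x : (-1) **: x = - x.
Proof. exact: (@scaleN1r K (lmod_of A)). Qed.
End PzAlgTheory.

Definition alg_hom (K : fieldType) (A B : pzAlgType K) (f : A -> B) : Prop :=
  [/\ f 1 = 1, {morph f : x y / x * y} &
      forall (c : K) (x y : A), f (c **: x + y) = c **: f x + f y].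

Inductive subalg (K : fieldType) (A : pzAlgType K) (S : A -> Prop) :
    A -> Prop :=
| subalg_gen x : S x -> subalg S x
| subalg_one : subalg S 1
| subalg_lin c x y : subalg S x -> subalg S y -> subalg S (c **: x + y)
| subalg_mul x y : subalg S x -> subalg S y -> subalg S (x * y).

Definition bilin (K : fieldType) (V W : pzAlgType K) (X : lmodType K)
    (b : V -> W -> X) : Prop :=
  (forall c v v' w, b (c **: v + v') w = c *: b v w + b v' w) /\
  (forall c v w w', b v (c **: w + w') = c *: b v w + b v w').

Definition bilin_form (K : fieldType) (V W : pzAlgType K) (b : V -> W -> K) :
    Prop :=
  @bilin K V W K^o b.

Section QuotientAlgebra.
Context {K : fieldType} {A : pzAlgType K}.
Variable S : A -> Prop.

Inductive ideal_gen : A -> Prop :=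
| ideal_gen_base x : S x -> ideal_gen x
| ideal_gen0 : ideal_gen 0
| ideal_genD x y : ideal_gen x -> ideal_gen y -> ideal_gen (x + y)
| ideal_genMl a x : ideal_gen x -> ideal_gen (a * x)
| ideal_genMr x a : ideal_gen x -> ideal_gen (x * a).

Lemma ideal_genN x : ideal_gen x -> ideal_gen (- x).
Proof. by move=> Ix; rewrite -mulN1r; apply: ideal_genMl. Qed.

Lemma ideal_genZ c x : ideal_gen x -> ideal_gen (c **: x).
Proof.
by move=> Ix; rewrite -[x]mul1r ascaleAl; apply: ideal_genMl.
Qed.

Definition quot_rel (x y : A) : bool := `[< ideal_gen (x - y) >].

Lemma quot_rel_refl : reflexive quot_rel.
Proof. by move=> x; apply/asboolP; rewrite subrr; apply: ideal_gen0. Qed.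

Lemma quot_rel_sym : symmetric quot_rel.
Proof.
by move=> x y; apply/asboolP/asboolP => /ideal_genN; rewrite opprB.
Qed.

Lemma quot_rel_trans : transitive quot_rel.
Proof.
move=> y x z /asboolP Ixy /asboolP Iyz; apply/asboolP.
by rewrite -(subrKA y); apply: ideal_genD.
Qed.

Canonical quot_equiv := EquivRel quot_rel
  quot_rel_refl quot_rel_sym quot_rel_trans.

Definition quot_alg : Type := {eq_quot quot_equiv}.
HB.instance Definition _ := Choice.on quot_alg.
HB.instance Definition _ := EqQuotient.on quot_alg.

End QuotientAlgebra.
Arguments quot_alg {K A} S.

(* Sealed, to keep conversion from unfolding the quotients. *)
HB.lock Definition quot_pi (K : fieldType) (A : pzAlgType K) (S : A -> Prop)
  (x : A) : quot_alg S := \pi_(quot_alg S) x.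
Canonical quot_pi_unlockable := Unlockable quot_pi.unlock.
Arguments quot_pi {K A S} x.
HB.lock Definition quot_add (K : fieldType) (A : pzAlgType K) (S : A -> Prop)
  (x y : quot_alg S) : quot_alg S := quot_pi (repr x + repr y).
Canonical quot_add_unlockable := Unlockable quot_add.unlock.
HB.lock Definition quot_opp (K : fieldType) (A : pzAlgType K) (S : A -> Prop)
  (x : quot_alg S) : quot_alg S := quot_pi (- repr x).
Canonical quot_opp_unlockable := Unlockable quot_opp.unlock.
HB.lock Definition quot_mul (K : fieldType) (A : pzAlgType K) (S : A -> Prop)
  (x y : quot_alg S) : quot_alg S := quot_pi (repr x * repr y).
Canonical quot_mul_unlockable := Unlockable quot_mul.unlock.
HB.lock Definition quot_scale (K : fieldType) (A : pzAlgType K)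
  (S : A -> Prop) (c : K) (x : quot_alg S) : quot_alg S :=
  quot_pi (c **: repr x).
Canonical quot_scale_unlockable := Unlockable quot_scale.unlock.

Section QuotientAlgebraTheory.
Context {K : fieldType} {A : pzAlgType K}.
Variable S : A -> Prop.
Local Notation quot_alg := (quot_alg S).
Local Notation quot_pi := (@quot_pi K A S).
Local Notation quot_add := (@quot_add K A S).
Local Notation quot_opp := (@quot_opp K A S).
Local Notation quot_mul := (@quot_mul K A S).
Local Notation quot_scale := (@quot_scale K A S).
Local Notation ideal_gen := (ideal_gen S).

Lemma quot_piP x y : quot_pi x = quot_pi y <-> ideal_gen (x - y).
Proof.
by rewrite unlock; split=> [/eqmodP /asboolP|Ixy] //; apply/eqmodP/asboolP.
Qed.

Lemma quot_reprK (x : quot_alg) : quot_pi (repr x) = x.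
Proof. by rewrite unlock; exact: reprK. Qed.

Lemma quot_repr x : ideal_gen (repr (quot_pi x) - x).
Proof. by apply/quot_piP; rewrite quot_reprK. Qed.

Definition quot_zero := quot_pi 0.
Definition quot_one := quot_pi 1.

Lemma quot_addE x y : quot_add (quot_pi x) (quot_pi y) = quot_pi (x + y).
Proof.
rewrite quot_add.unlock; apply/quot_piP; rewrite opprD addrACA.
by apply: ideal_genD; apply: quot_repr.
Qed.

Lemma quot_oppE x : quot_opp (quot_pi x) = quot_pi (- x).
Proof.
rewrite quot_opp.unlock; apply/quot_piP; rewrite -opprD.
exact/ideal_genN/quot_repr.
Qed.

Lemma quot_scaleE c x : quot_scale c (quot_pi x) = quot_pi (c **: x).
Proof.
rewrite quot_scale.unlock; apply/quot_piP; rewrite -ascaleBr.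
exact/ideal_genZ/quot_repr.
Qed.

Lemma quot_mulE x y : quot_mul (quot_pi x) (quot_pi y) = quot_pi (x * y).
Proof.
rewrite quot_mul.unlock; apply/quot_piP; set x' := repr _; set y' := repr _.
have -> : x' * y' - x * y = (x' - x) * y' + x * (y' - y).
  by rewrite mulrBl mulrBr addrA subrK.
by apply: ideal_genD; [apply: ideal_genMr | apply: ideal_genMl];
   apply: quot_repr.
Qed.

Lemma quot_ind (P : quot_alg -> Prop) :
  (forall x, P (quot_pi x)) -> forall x, P x.
Proof. by move=> H x; rewrite -[x]quot_reprK. Qed.

Fact quot_addA : associative quot_add.
Proof.
by do 3![elim/quot_ind => ?]; rewrite !quot_addE addrA.
Qed.
Fact quot_addC : commutative quot_add.
Proof. by do 2![elim/quot_ind => ?]; rewrite !quot_addE addrC. Qed.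
Fact quot_add0 : left_id quot_zero quot_add.
Proof. by elim/quot_ind => ?; rewrite quot_addE add0r. Qed.
Fact quot_addN : left_inverse quot_zero quot_opp quot_add.
Proof. by elim/quot_ind => ?; rewrite quot_oppE quot_addE addNr. Qed.
HB.instance Definition _ := GRing.isZmodule.Build quot_alg
  quot_addA quot_addC quot_add0 quot_addN.

Fact quot_mulA : associative quot_mul.
Proof. by do 3![elim/quot_ind => ?]; rewrite !quot_mulE mulrA. Qed.
Fact quot_mul1l : left_id quot_one quot_mul.
Proof. by elim/quot_ind => ?; rewrite quot_mulE mul1r. Qed.
Fact quot_mul1r : right_id quot_one quot_mul.
Proof. by elim/quot_ind => ?; rewrite quot_mulE mulr1. Qed.
Fact quot_mulDl : left_distributive quot_mul +%R.
Proof.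
do 3![elim/quot_ind => ?].
by rewrite /GRing.add /= !(quot_mulE, quot_addE) mulrDl.
Qed.
Fact quot_mulDr : right_distributive quot_mul +%R.
Proof.
do 3![elim/quot_ind => ?].
by rewrite /GRing.add /= !(quot_mulE, quot_addE) mulrDr.
Qed.
HB.instance Definition _ := GRing.Zmodule_isPzRing.Build quot_alg
  quot_mulA quot_mul1l quot_mul1r quot_mulDl quot_mulDr.

Fact quot_scaleA a b x : quot_scale a (quot_scale b x) = quot_scale (a * b) x.
Proof. by elim/quot_ind: x => x; rewrite !quot_scaleE ascaleA. Qed.
Fact quot_scale1 x : quot_scale 1 x = x.
Proof. by elim/quot_ind: x => x; rewrite quot_scaleE ascale1. Qed.
Fact quot_scaleDr a (x y : quot_alg) :
  quot_scale a (x + y) = quot_scale a x + quot_scale a y.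
Proof.
elim/quot_ind: x => x; elim/quot_ind: y => y.
by rewrite /GRing.add /= !(quot_scaleE, quot_addE) ascaleDr.
Qed.
Fact quot_scaleDl a b (x : quot_alg) :
  quot_scale (a + b) x = quot_scale a x + quot_scale b x.
Proof.
elim/quot_ind: x => x.
by rewrite [in RHS]/GRing.add /= !(quot_scaleE, quot_addE) ascaleDl.
Qed.
Fact quot_scaleAl c (x y : quot_alg) :
  quot_scale c (x * y) = quot_scale c x * y.
Proof.
elim/quot_ind: x => x; elim/quot_ind: y => y.
by rewrite /GRing.mul /= !(quot_scaleE, quot_mulE) ascaleAl.
Qed.
Fact quot_scaleAr c (x y : quot_alg) :
  quot_scale c (x * y) = x * quot_scale c y.
Proof.
elim/quot_ind: x => x; elim/quot_ind: y => y.
by rewrite /GRing.mul /= !(quot_scaleE, quot_mulE) ascaleAr.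
Qed.
HB.instance Definition _ := PzRing_isPzAlg.Build K quot_alg
  quot_scaleA quot_scale1 quot_scaleDr quot_scaleDl quot_scaleAl quot_scaleAr.

Lemma quot_pi_hom : alg_hom quot_pi.
Proof.
split=> // [x y|c x y]; first by rewrite -quot_mulE.
by rewrite -quot_addE -quot_scaleE.
Qed.

Lemma quot_pi_eq0 x : S x -> quot_pi x = 0.
Proof. by move=> Sx; apply/quot_piP; rewrite subr0; apply: ideal_gen_base. Qed.

Definition quot_lift (B : pzAlgType K) (f : A -> B) (x : quot_alg) : B :=
  f (repr x).

Lemma quot_liftE (B : pzAlgType K) (f : A -> B) :
  alg_hom f -> (forall x, S x -> f x = 0) ->
  forall x, quot_lift f (quot_pi x) = f x.
Proof.
move=> [_ fM fL] fS x.
have f0 : f 0 = 0.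
  by have := fL (-1) 0 0; rewrite ascaleN1 addNr ascaleN1 addNr.
have fD u v : f (u + v) = f u + f v by have := fL 1 u v; rewrite !ascale1.
have fN u : f (- u) = - f u.
  by have := fL (-1) u 0; rewrite f0 !addr0 !ascaleN1.
have fI : forall z, ideal_gen z -> f z = 0.
  move=> z; elim=> [u|//|u v _ fu _ fv|a u _ fu|u a _ fu]; first exact: fS.
  - by rewrite fD fu fv addr0.
  - by rewrite fM fu mulr0.
  - by rewrite fM fu mul0r.
by apply/eqP; rewrite -subr_eq0 -fN -fD fI //; apply: quot_repr.
Qed.

Lemma quot_lift_hom (B : pzAlgType K) (f : A -> B) :
  alg_hom f -> (forall x, S x -> f x = 0) -> alg_hom (quot_lift f).
Proof.
move=> fH fS; have E := quot_liftE fH fS; have [p1 pM pL] := quot_pi_hom.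
have [f1 fM fL] := fH.
split=> [|x y|c x y]; first by rewrite -p1 E.
  by elim/quot_ind: x => x; elim/quot_ind: y => y; rewrite -pM !E fM.
by elim/quot_ind: x => x; elim/quot_ind: y => y; rewrite -pL !E fL.
Qed.

End QuotientAlgebraTheory.

Definition free_alg (K : fieldType) (T : choiceType) : Type :=
  {malg K[{fmonom T}]}.

Section FreeAlgebra.
Context {K : fieldType} {T : choiceType}.
Local Notation FA := (free_alg K T).

HB.instance Definition _ := GRing.Lalgebra.on FA.

Fact free_scaleAr (c : K) (x y : FA) : c *: (x * y) = x * (c *: y).
Proof.
apply/malgP => k; rewrite mcoeffZ mcoeffMl.
rewrite (mcoeffMlw _ (fsubset_refl _) (msuppZ_le c y)) mulr_sumr.
apply: eq_bigr => u _; rewrite mulr_sumr; apply: eq_bigr => v _.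
by rewrite mcoeffZ mulrnAr mulrCA.
Qed.

HB.instance Definition _ := PzRing_isPzAlg.Build K FA
  (@scalerA K FA) (@scale1r K FA) (@scalerDr K FA)
  (fun b c x => @scalerDl K FA x b c) (@scalerAl K FA) free_scaleAr.

End FreeAlgebra.

HB.lock Definition free_gen (K : fieldType) (T : choiceType) (t : T) :
  free_alg K T := << fmu t >>.
Canonical free_gen_unlockable := Unlockable free_gen.unlock.
Arguments free_gen {K T} t.

Section FreeLift.
Context {K : fieldType} {T : choiceType}.
Local Notation FA := (free_alg K T).

Section Lift.
Context {A : pzAlgType K}.
Variable g : T -> A.

Definition word_lift (w : seq T) : A := \prod_(t <- w) g t.

Definition free_lift (x : FA) : A :=
  \sum_(w <- msupp x) x@_w **: word_lift w.

Lemma free_liftEw (d : {fset {fmonom T}}) (x : FA) : (msupp x `<=` d)%fset ->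
  free_lift x = \sum_(w <- d) x@_w **: word_lift w.
Proof.
move=> le; rewrite [LHS](big_fset_incl _ le) //= => w _ /mcoeff_outdom ->.
exact: (@scale0r K (lmod_of A)).
Qed.

Lemma free_liftU c w : free_lift << c *g w >> = c **: word_lift w.
Proof. by rewrite (free_liftEw (msuppU_le)) big_seq_fset1 mcoeffUU. Qed.

Lemma free_lift_gen t : free_lift (free_gen t) = g t.
Proof. by rewrite unlock free_liftU ascale1 /word_lift fmU big_seq1. Qed.

Lemma free_lift_lin c (x y : FA) :
  free_lift (c **: x + y) = c **: free_lift x + free_lift y.
Proof.
pose d := (msupp x `|` msupp y)%fset.
have dx : (msupp x `<=` d)%fset by apply: fsubsetUl.
have dy : (msupp y `<=` d)%fset by apply: fsubsetUr.
have dxy : (msupp (c **: x + y : FA) `<=` d)%fset.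
  apply: (fsubset_trans (msuppD_le _ _)); rewrite fsubUset dy andbT.
  by apply: (fsubset_trans (msuppZ_le _ _)).
rewrite (free_liftEw dx) (free_liftEw dy) (free_liftEw dxy).
rewrite [c **: \sum_(_ <- _) _](@scaler_sumr K (lmod_of A)) -big_split /=.
apply: eq_bigr => w _; rewrite mcoeffD [(c **: x)@_w]mcoeffZ ascaleDl.
by rewrite -ascaleA.
Qed.

Lemma free_lift_hom : alg_hom free_lift.
Proof.
have fD (x y : FA) : free_lift (x + y) = free_lift x + free_lift y.
  by have := free_lift_lin 1 x y; rewrite !ascale1.
have f0 : free_lift 0 = 0 by rewrite /free_lift msupp0 big_seq_fset0.
have fsum (I : Type) (s : seq I) (F : I -> {malg K[{fmonom T}]}) :
    free_lift (\sum_(i <- s) F i) = \sum_(i <- s) free_lift (F i).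
  exact: (big_morph free_lift fD f0).
split=> [|x y|]; last exact: free_lift_lin.
  by rewrite [LHS]free_liftU ascale1 /word_lift fm1 big_nil.
rewrite [x * y](malgME x y) fsum [in RHS]/free_lift mulr_suml.
apply: eq_bigr => u _; rewrite fsum mulr_sumr.
apply: eq_bigr => v _; rewrite free_liftU -ascaleAl -ascaleAr ascaleA.
by rewrite /word_lift fmM big_cat.
Qed.

End Lift.
End FreeLift.

(* The tensor product over K: a tensor is a finite formal sum of pairs, and
   two sums are identified when every bilinear map takes the same value on
   them. *)
Section Tensor.
Context {K : fieldType} {A B : pzAlgType K}.

Definition pairs_eval (X : nmodType) (b : A -> B -> X) (s : seq (A * B)) : X :=
  \sum_(p <- s) b p.1 p.2.

Definition tensor_rel (s t : seq (A * B)) : bool :=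
  `[< forall (X : lmodType K) (b : A -> B -> X),
        bilin b -> pairs_eval b s = pairs_eval b t >].

Lemma tensor_rel_refl : reflexive tensor_rel.
Proof. by move=> s; apply/asboolP. Qed.
Lemma tensor_rel_sym : symmetric tensor_rel.
Proof. by move=> s t; apply/asboolP/asboolP => H X b /H. Qed.
Lemma tensor_rel_trans : transitive tensor_rel.
Proof.
move=> t s u /asboolP Hst /asboolP Htu; apply/asboolP => X b bb.
by rewrite Hst // Htu.
Qed.

Canonical tensor_equiv := EquivRel tensor_rel
  tensor_rel_refl tensor_rel_sym tensor_rel_trans.

Definition tensor : Type := {eq_quot tensor_equiv}.
HB.instance Definition _ := Choice.on tensor.
HB.instance Definition _ := EqQuotient.on tensor.

Definition tensor_of (s : seq (A * B)) : tensor := \pi_tensor s.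
Definition pure (x : A) (y : B) : tensor := tensor_of [:: (x, y)].

(* The linear map on A (x) B induced by b; independent of the chosen
   representative as soon as b is bilinear (tensor_liftE). *)
Definition tensor_lift (X : nmodType) (b : A -> B -> X) (t : tensor) : X :=
  pairs_eval b (repr t).

Lemma tensor_liftE (X : lmodType K) (b : A -> B -> X) s : bilin b ->
  tensor_lift b (tensor_of s) = pairs_eval b s.
Proof.
move=> bb; have /eqmodP /asboolP : tensor_of (repr (tensor_of s)) = tensor_of s.
  exact: reprK.
exact.
Qed.

Lemma tensorP (x y : tensor) :
  (forall (X : lmodType K) (b : A -> B -> X),
     bilin b -> tensor_lift b x = tensor_lift b y) -> x = y.
Proof.
move=> H; rewrite -[x]reprK -[y]reprK; apply/eqmodP/asboolP; exact: H.
Qed.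

Lemma bilinDl (X : lmodType K) (b : A -> B -> X) : bilin b ->
  forall x x' y, b (x + x') y = b x y + b x' y.
Proof. by case=> bl _ x x' y; have := bl 1 x x' y; rewrite ascale1 scale1r. Qed.
Lemma bilinZl (X : lmodType K) (b : A -> B -> X) : bilin b ->
  forall c x y, b (c **: x) y = c *: b x y.
Proof.
move=> bb c x y; have [bl _] := bb.
have b0 : b 0 y = 0.
  by apply: (@addrI _ (b 0 y)); rewrite -bilinDl // !addr0.
by have := bl c x 0 y; rewrite b0 !addr0.
Qed.

Definition tensor_zero : tensor := tensor_of [::].
Definition tensor_one : tensor := pure 1 1.
Definition tensor_add (x y : tensor) := tensor_of (repr x ++ repr y).
Definition tensor_scale (c : K) (x : tensor) :=
  tensor_of [seq (c **: p.1, p.2) | p <- repr x].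
Definition tensor_opp (x : tensor) := tensor_scale (-1) x.
Definition tensor_mul (x y : tensor) :=
  tensor_of [seq (p.1 * p'.1, p.2 * p'.2) | p <- repr x, p' <- repr y].

Section LiftTheory.
Context {X : lmodType K} {b : A -> B -> X} (bb : bilin b).

Lemma tensor_lift0 : tensor_lift b tensor_zero = 0.
Proof. by rewrite tensor_liftE // /pairs_eval big_nil. Qed.
Lemma tensor_lift_pure x y : tensor_lift b (pure x y) = b x y.
Proof. by rewrite tensor_liftE // /pairs_eval big_seq1. Qed.
Lemma tensor_liftD x y :
  tensor_lift b (tensor_add x y) = tensor_lift b x + tensor_lift b y.
Proof. by rewrite tensor_liftE // /pairs_eval big_cat. Qed.
Lemma tensor_liftZ c x :
  tensor_lift b (tensor_scale c x) = c *: tensor_lift b x.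
Proof.
rewrite tensor_liftE // /pairs_eval big_map scaler_sumr.
by apply: eq_bigr => p _; rewrite bilinZl.
Qed.
Lemma tensor_liftM x y :
  tensor_lift b (tensor_mul x y) =
  tensor_lift (fun a1 b1 =>
    tensor_lift (fun a2 b2 => b (a1 * a2) (b1 * b2)) y) x.
Proof.
by rewrite tensor_liftE // /pairs_eval big_allpairs_dep.
Qed.

Lemma bilin_mull a1 b1 : bilin (fun a2 b2 => b (a1 * a2) (b1 * b2)).
Proof.
by case: bb => bl br; split=> c v v' w; rewrite mulrDr -ascaleAr ?bl ?br.
Qed.
Lemma bilin_mulr a2 b2 : bilin (fun a1 b1 => b (a1 * a2) (b1 * b2)).
Proof.
by case: bb => bl br; split=> c v v' w; rewrite mulrDl -ascaleAl ?bl ?br.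
Qed.
Lemma bilin_mul_lift y :
  bilin (fun a1 b1 => tensor_lift (fun a2 b2 => b (a1 * a2) (b1 * b2)) y).
Proof.
split=> c v v' w; rewrite /tensor_lift /pairs_eval scaler_sumr -big_split /=;
  apply: eq_bigr => p _.
  by have [-> _] := bilin_mulr p.1 p.2.
by have [_ ->] := bilin_mulr p.1 p.2.
Qed.
End LiftTheory.

Fact tensor_addA : associative tensor_add.
Proof.
by move=> x y z; apply: tensorP => X b bb; rewrite !tensor_liftD // addrA.
Qed.
Fact tensor_addC : commutative tensor_add.
Proof.
by move=> x y; apply: tensorP => X b bb; rewrite !tensor_liftD // addrC.
Qed.
Fact tensor_add0 : left_id tensor_zero tensor_add.
Proof.
move=> x; apply: tensorP => X b bb.
by rewrite tensor_liftD // tensor_lift0 // add0r.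
Qed.
Fact tensor_addN : left_inverse tensor_zero tensor_opp tensor_add.
Proof.
move=> x; apply: tensorP => X b bb.
by rewrite tensor_liftD // tensor_liftZ // tensor_lift0 // scaleN1r addNr.
Qed.
HB.instance Definition _ := GRing.isZmodule.Build tensor
  tensor_addA tensor_addC tensor_add0 tensor_addN.

Fact tensor_mulA : associative tensor_mul.
Proof.
move=> x y z; apply: tensorP => X b bb.
rewrite !tensor_liftM //; last exact: bilin_mul_lift.
apply: eq_bigr => p _; rewrite tensor_liftM; last exact: bilin_mull.
apply: eq_bigr => p' _; apply: eq_bigr => p'' _.
by rewrite !mulrA.
Qed.
Fact tensor_mul1l : left_id tensor_one tensor_mul.
Proof.
move=> x; apply: tensorP => X b bb; rewrite tensor_liftM //.
rewrite tensor_lift_pure; last exact: bilin_mul_lift.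
by apply: eq_bigr => p _; rewrite !mul1r.
Qed.
Fact tensor_mul1r : right_id tensor_one tensor_mul.
Proof.
move=> x; apply: tensorP => X b bb; rewrite tensor_liftM //.
apply: eq_bigr => p _; rewrite tensor_lift_pure; last exact: bilin_mull.
by rewrite !mulr1.
Qed.
Fact tensor_mulDl : left_distributive tensor_mul +%R.
Proof.
move=> x y z; apply: tensorP => X b bb; rewrite /GRing.add /=.
rewrite tensor_liftD // !tensor_liftM // tensor_liftD //.
exact: bilin_mul_lift.
Qed.
Fact tensor_mulDr : right_distributive tensor_mul +%R.
Proof.
move=> x y z; apply: tensorP => X b bb; rewrite /GRing.add /=.
rewrite tensor_liftD // !tensor_liftM //.
rewrite [LHS]/tensor_lift [X in _ = X + _]/tensor_lift.
rewrite [X in _ = _ + X]/tensor_lift /pairs_eval -big_split /=.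
by apply: eq_bigr => p _; rewrite tensor_liftD //; apply: bilin_mull.
Qed.
HB.instance Definition _ := GRing.Zmodule_isPzRing.Build tensor
  tensor_mulA tensor_mul1l tensor_mul1r tensor_mulDl tensor_mulDr.

Fact tensor_scaleA c d x :
  tensor_scale c (tensor_scale d x) = tensor_scale (c * d) x.
Proof. by apply: tensorP => X b bb; rewrite !tensor_liftZ // scalerA. Qed.
Fact tensor_scale1 x : tensor_scale 1 x = x.
Proof. by apply: tensorP => X b bb; rewrite tensor_liftZ // scale1r. Qed.
Fact tensor_scaleDr c (x y : tensor) :
  tensor_scale c (x + y) = tensor_scale c x + tensor_scale c y.
Proof.
apply: tensorP => X b bb; rewrite /GRing.add /=.
by rewrite !(tensor_liftZ, tensor_liftD) // scalerDr.
Qed.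
Fact tensor_scaleDl c d (x : tensor) :
  tensor_scale (c + d) x = tensor_scale c x + tensor_scale d x.
Proof.
apply: tensorP => X b bb; rewrite [in RHS]/GRing.add /=.
by rewrite !(tensor_liftZ, tensor_liftD) // scalerDl.
Qed.
Fact tensor_scaleAl c (x y : tensor) :
  tensor_scale c (x * y) = tensor_scale c x * y.
Proof.
apply: tensorP => X b bb; rewrite /GRing.mul /=.
rewrite !(tensor_liftZ, tensor_liftM) //.
exact: bilin_mul_lift.
Qed.
Fact tensor_scaleAr c (x y : tensor) :
  tensor_scale c (x * y) = x * tensor_scale c y.
Proof.
apply: tensorP => X b bb; rewrite /GRing.mul /=.
rewrite !(tensor_liftZ, tensor_liftM) //.
rewrite [X in _ = X]/tensor_lift [X in _ *: X]/tensor_lift /pairs_eval.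
rewrite scaler_sumr; apply: eq_bigr => p _.
by rewrite tensor_liftZ //; apply: bilin_mull.
Qed.
HB.instance Definition _ := PzRing_isPzAlg.Build K tensor
  tensor_scaleA tensor_scale1 tensor_scaleDr tensor_scaleDl
  tensor_scaleAl tensor_scaleAr.

End Tensor.
Arguments tensor {K} A B.

Section AlgHomTheory.
Context {K : fieldType} {A B : pzAlgType K} {f : A -> B} (fH : alg_hom f).

Lemma alg_hom1 : f 1 = 1. Proof. by case: fH. Qed.
Lemma alg_homM x y : f (x * y) = f x * f y. Proof. by case: fH. Qed.
Lemma alg_homD x y : f (x + y) = f x + f y.
Proof. by case: fH => _ _ /(_ 1 x y); rewrite !ascale1. Qed.
Lemma alg_hom0 : f 0 = 0.
Proof. by apply: (@addrI _ (f 0)); rewrite -alg_homD !addr0. Qed.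
Lemma alg_homZ c x : f (c **: x) = c **: f x.
Proof. by case: fH => _ _ /(_ c x 0); rewrite alg_hom0 !addr0. Qed.
Lemma alg_homB x y : f (x - y) = f x - f y.
Proof. by rewrite -ascaleN1 alg_homD alg_homZ ascaleN1. Qed.
Lemma alg_homX x n : f (x ^+ n) = f x ^+ n.
Proof. by elim: n => [|n IHn]; rewrite ?alg_hom1 // !exprS alg_homM IHn. Qed.
Lemma alg_hom_sum (J : Type) (s : seq J) (F : J -> A) :
  f (\sum_(j <- s) F j) = \sum_(j <- s) f (F j).
Proof. exact: (big_morph f alg_homD alg_hom0). Qed.
End AlgHomTheory.

Definition Qq : fieldType := {fraction {poly rat}}.
Definition q : Qq := tofrac 'X.

(* nu = n / d with d(0) <> 0, and the power series of nu at q = 0 is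
   \sum_k (s k) q ^ k with s k in nat and s 0 = 1 (i.e. n = s * d). *)
Definition in_one_plus_qNq (nu : Qq) : Prop :=
  exists (n d : {poly rat}) (s : nat -> nat),
    [/\ d`_0 != 0, nu = tofrac n / tofrac d, s 0%N = 1%N &
        forall m, n`_m = \sum_(k < m.+1) (s k)%:R * d`_(m - k)].

Record cartan_datum (I : countType) := CartanDatum {
  cartan_a : I -> I -> int;
  cartan_r : I -> nat;
  cartan_diag : forall i, exists n : nat, cartan_a i i = 2 - (n.*2)%:Z;
  cartan_offdiag : forall i j, i != j -> cartan_a i j <= 0;
  cartan_r_gt0 : forall i, (0 < cartan_r i)%N;
  cartan_sym : forall i j,
    (cartan_r i)%:Z * cartan_a i j = (cartan_r j)%:Z * cartan_a j i
}.

Section CartanDatum.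
Context {I : countType} (C : cartan_datum I).
Local Notation a := (cartan_a C).
Local Notation r := (cartan_r C).

Definition is_re (i : I) : bool := a i i == 2.
Definition is_im (i : I) : bool := a i i <= 0.

Definition in_Iinf (x : I * nat) : bool :=
  (is_re x.1 && (x.2 == 1%N)) || (is_im x.1 && (0 < x.2)%N).
Definition Iinf : choiceType := {x : I * nat | in_Iinf x}.

(* P^vee, with basis h_i (left copy of I) and d_i (right copy). *)
Definition coweight : zmodType := {malg int[(I + I)%type]}.
Definition h_ (i : I) : coweight := << inl i >>.
Definition d_ (i : I) : coweight := << inr i >>.

(* alpha_j(h) *)
Definition alpha (j : I) (h : coweight) : int :=
  \sum_(x <- msupp h)
    h@_x * match x with inl i => a i j | inr i => (i == j)%:Z end.

(* The alpha_i are linearly independent, so the root lattice is free. *)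
Definition root_lattice : zmodType := {malg int[I]}.
Definition root_form (b c : root_lattice) : int :=
  \sum_(i <- msupp b) \sum_(j <- msupp c) b@_i * c@_j * ((r i)%:Z * a i j).

Definition q_ (i : I) : Qq := q ^+ r i.
(* q_(i) = q ^ ((alpha_i, alpha_i) / 2); the division is exact because a i i
   is even. *)
Definition qp (i : I) : Qq := q ^ (((r i)%:Z * a i i) %/ 2)%Z.

Definition qint (i : I) (n : nat) : Qq :=
  (q_ i ^+ n - q_ i ^- n) / (q_ i - (q_ i)^-1).
Definition qfact (i : I) (n : nat) : Qq := \prod_(1 <= m < n.+1) qint i m.
Definition qbinom (i : I) (n k : nat) : Qq :=
  qfact i n / (qfact i k * qfact i (n - k)).

(* x_{il} for a family x indexed by Iinf, with x_{i0} = 1; the value 0 when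
   l > 0 and (i, l) is not in Iinf is never used. *)
Definition at_ (A : pzRingType) (x : Iinf -> A) (i : I) (l : nat) : A :=
  if l == 0%N then 1 else if insub (i, l) is Some u then x u else 0.

(* The q-Serre element; the exponent 1 - l a_ij is nonnegative where it is
   used. *)
Definition serre (A : pzAlgType Qq) (x : Iinf -> A) (i j : I) (l : nat) : A :=
  let N := absz (1 - l%:Z * a i j)%R in
  \sum_(0 <= k < N.+1) ((-1) ^+ k * qbinom i N k) **:
    (at_ x i 1 ^+ (N - k) * at_ x j l * at_ x i 1 ^+ k).

Definition Ugen : choiceType := (coweight + (Iinf + Iinf))%type.
Definition Ufree : pzAlgType Qq := free_alg Qq Ugen.
Definition gen_q (h : coweight) : Ufree := free_gen (inl h).
Definition gen_e (x : Iinf) : Ufree := free_gen (inr (inl x)).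
Definition gen_f (x : Iinf) : Ufree := free_gen (inr (inr x)).

Inductive Uhat_rel : Ufree -> Prop :=
| rel_q0 : Uhat_rel (gen_q 0 - 1)
| rel_qD h h' : Uhat_rel (gen_q h * gen_q h' - gen_q (h + h'))
| rel_qe h j l : in_Iinf (j, l) ->
    Uhat_rel (gen_q h * at_ gen_e j l * gen_q (- h)
              - (q ^ (l%:Z * alpha j h)) **: at_ gen_e j l)
| rel_qf h j l : in_Iinf (j, l) ->
    Uhat_rel (gen_q h * at_ gen_f j l * gen_q (- h)
              - (q ^ (- (l%:Z * alpha j h))) **: at_ gen_f j l)
| rel_serre_e i j l : is_re i -> in_Iinf (j, l) -> (i, 1%N) <> (j, l) ->
    Uhat_rel (serre gen_e i j l)
| rel_serre_f i j l : is_re i -> in_Iinf (j, l) -> (i, 1%N) <> (j, l) ->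
    Uhat_rel (serre gen_f i j l)
| rel_comm_e i k j l : in_Iinf (i, k) -> in_Iinf (j, l) -> a i j = 0 ->
    Uhat_rel (at_ gen_e i k * at_ gen_e j l - at_ gen_e j l * at_ gen_e i k)
| rel_comm_f i k j l : in_Iinf (i, k) -> in_Iinf (j, l) -> a i j = 0 ->
    Uhat_rel (at_ gen_f i k * at_ gen_f j l - at_ gen_f j l * at_ gen_f i k).

Definition Uhat : pzAlgType Qq := quot_alg Uhat_rel.

Definition qh (h : coweight) : Uhat := quot_pi (gen_q h).
Definition e_ (i : I) (l : nat) : Uhat := at_ (fun x => quot_pi (gen_e x)) i l.
Definition f_ (i : I) (l : nat) : Uhat := at_ (fun x => quot_pi (gen_f x)) i l.
Definition K_ (i : I) : Uhat := qh (h_ i *+ r i).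
Definition Kinv_ (i : I) : Uhat := qh (- (h_ i *+ r i)).

Lemma alphaN j h : alpha j (- h) = - alpha j h.
Proof.
rewrite /alpha msuppN -sumrN; apply: eq_bigr => x _.
by rewrite mcoeffN mulNr.
Qed.

Lemma at_hom (A B : pzAlgType Qq) (f : A -> B) (x : Iinf -> A) i l :
  alg_hom f -> f (at_ x i l) = at_ (fun u => f (x u)) i l.
Proof.
move=> fH; rewrite /at_; case: eqP => _; first exact: alg_hom1.
by case: insub => [u|] //; apply: (alg_hom0 fH).
Qed.

Lemma serre_hom (A B : pzAlgType Qq) (f : A -> B) (x : Iinf -> A) i j l :
  alg_hom f -> f (serre x i j l) = serre (fun u => f (x u)) i j l.
Proof.
move=> fH; rewrite /serre (alg_hom_sum fH); apply: eq_bigr => k _.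
by rewrite (alg_homZ fH) !(alg_homM fH) !(alg_homX fH) !(at_hom _ _ _ fH).
Qed.

Lemma Uhat_eqE x y : Uhat_rel (x - y) -> quot_pi x = quot_pi y :> Uhat.
Proof. by move=> rxy; apply/quot_piP/ideal_gen_base. Qed.

Lemma qh0 : qh 0 = 1. Proof. exact: (Uhat_eqE rel_q0). Qed.
Lemma qhD h h' : qh (h + h') = qh h * qh h'.
Proof. by rewrite /qh -(Uhat_eqE (rel_qD h h')) (alg_homM (quot_pi_hom _)). Qed.
Lemma qh_e h j l : in_Iinf (j, l) ->
  qh h * e_ j l * qh (- h) = (q ^ (l%:Z * alpha j h)) **: e_ j l.
Proof.
move=> /(rel_qe h) /Uhat_eqE; have piH := quot_pi_hom Uhat_rel.
by rewrite (alg_homZ piH) !(alg_homM piH) !(at_hom _ _ _ piH).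
Qed.
Lemma qh_f h j l : in_Iinf (j, l) ->
  qh h * f_ j l * qh (- h) = (q ^ (- (l%:Z * alpha j h))) **: f_ j l.
Proof.
move=> /(rel_qf h) /Uhat_eqE; have piH := quot_pi_hom Uhat_rel.
by rewrite (alg_homZ piH) !(alg_homM piH) !(at_hom _ _ _ piH).
Qed.

Lemma Uhat_comme i k j l : in_Iinf (i, k) -> in_Iinf (j, l) -> a i j = 0 ->
  e_ i k * e_ j l = e_ j l * e_ i k.
Proof.
move=> ik jl a0.
have piM i' k' j' l' : quot_pi (at_ gen_e i' k' * at_ gen_e j' l')
    = e_ i' k' * e_ j' l'.
  have E i2 l2 := @at_hom _ _ _ gen_e i2 l2 (quot_pi_hom Uhat_rel).
  by rewrite (alg_homM (quot_pi_hom _)) /e_ -E -E.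
rewrite -(piM i k j l) -(piM j l i k).
exact: Uhat_eqE (rel_comm_e ik jl a0).
Qed.
Lemma Uhat_commf i k j l : in_Iinf (i, k) -> in_Iinf (j, l) -> a i j = 0 ->
  f_ i k * f_ j l = f_ j l * f_ i k.
Proof.
move=> ik jl a0.
have piM i' k' j' l' : quot_pi (at_ gen_f i' k' * at_ gen_f j' l')
    = f_ i' k' * f_ j' l'.
  have E i2 l2 := @at_hom _ _ _ gen_f i2 l2 (quot_pi_hom Uhat_rel).
  by rewrite (alg_homM (quot_pi_hom _)) /f_ -E -E.
rewrite -(piM i k j l) -(piM j l i k).
exact: Uhat_eqE (rel_comm_f ik jl a0).
Qed.

Definition omega_gen (t : Ugen) : Uhat :=
  match t with
  | inl h => qh (- h)
  | inr (inl x) => quot_pi (gen_f x)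
  | inr (inr x) => quot_pi (gen_e x)
  end.
Definition omega : Uhat -> Uhat := quot_lift (free_lift omega_gen).

Lemma omega_rel x : Uhat_rel x -> free_lift omega_gen x = 0.
Proof.
have gH := free_lift_hom omega_gen; have piH := quot_pi_hom Uhat_rel.
have gq h : free_lift omega_gen (gen_q h) = qh (- h) by rewrite free_lift_gen.
have ge' : (fun u => free_lift omega_gen (gen_e u))
    = (fun u => quot_pi (gen_f u)) by apply/funext => u; rewrite free_lift_gen.
have gf' : (fun u => free_lift omega_gen (gen_f u))
    = (fun u => quot_pi (gen_e u)) by apply/funext => u; rewrite free_lift_gen.
have ge i l : free_lift omega_gen (at_ gen_e i l) = f_ i l.
  by rewrite (at_hom _ _ _ gH) ge'.
have gf i l : free_lift omega_gen (at_ gen_f i l) = e_ i l.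
  by rewrite (at_hom _ _ _ gH) gf'.
have geM i k j l : free_lift omega_gen (at_ gen_e i k * at_ gen_e j l)
    = f_ i k * f_ j l by rewrite (alg_homM gH) !ge.
have gfM i k j l : free_lift omega_gen (at_ gen_f i k * at_ gen_f j l)
    = e_ i k * e_ j l by rewrite (alg_homM gH) !gf.
case=> [|h h'|h j l jl|h j l jl|i j l re_i jl ne|i j l re_i jl ne
       |i k j l ik jl a0|i k j l ik jl a0].
- by rewrite (alg_homB gH) (alg_hom1 gH) gq oppr0 qh0 subrr.
- by rewrite (alg_homB gH) (alg_homM gH) !gq opprD qhD subrr.
- rewrite (alg_homB gH) (alg_homZ gH) !(alg_homM gH) !gq ge qh_f //.
  by rewrite alphaN mulrN opprK subrr.
- rewrite (alg_homB gH) (alg_homZ gH) !(alg_homM gH) !gq gf qh_e //.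
  by rewrite alphaN mulrN subrr.
- rewrite (serre_hom _ _ _ _ gH) ge'.
  have := quot_pi_eq0 (rel_serre_f re_i jl ne).
  by rewrite (serre_hom _ _ _ _ piH).
- rewrite (serre_hom _ _ _ _ gH) gf'.
  have := quot_pi_eq0 (rel_serre_e re_i jl ne).
  by rewrite (serre_hom _ _ _ _ piH).
- rewrite (alg_homB gH); apply/eqP; rewrite subr_eq0; apply/eqP.
  have H1 := geM i k j l; have H2 := geM j l i k.
  exact (eq_trans H1 (eq_trans (Uhat_commf ik jl a0) (esym H2))).
- rewrite (alg_homB gH); apply/eqP; rewrite subr_eq0; apply/eqP.
  have H1 := gfM i k j l; have H2 := gfM j l i k.
  exact (eq_trans H1 (eq_trans (Uhat_comme ik jl a0) (esym H2))).
Qed.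

Lemma omega_hom : alg_hom omega.
Proof. exact: quot_lift_hom (free_lift_hom _) omega_rel. Qed.

Lemma omega_qh h : omega (qh h) = qh (- h).
Proof.
by rewrite /omega (quot_liftE (free_lift_hom _) omega_rel) free_lift_gen.
Qed.

Lemma omega_e i l : omega (e_ i l) = f_ i l.
Proof.
rewrite /e_ (at_hom _ _ _ omega_hom); congr at_; apply/funext => u.
by rewrite /omega (quot_liftE (free_lift_hom _) omega_rel) free_lift_gen.
Qed.

Lemma omega_f i l : omega (f_ i l) = e_ i l.
Proof.
rewrite /f_ (at_hom _ _ _ omega_hom); congr at_; apply/funext => u.
by rewrite /omega (quot_liftE (free_lift_hom _) omega_rel) free_lift_gen.
Qed.

Definition Uneg : Uhat -> Prop :=
  subalg (fun x => exists i l, in_Iinf (i, l) /\ x = f_ i l).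
Definition Upos : Uhat -> Prop :=
  subalg (fun x => exists i l, in_Iinf (i, l) /\ x = e_ i l).
Definition Uneg0 : Uhat -> Prop :=
  subalg (fun x => (exists i l, in_Iinf (i, l) /\ x = f_ i l) \/
                   (exists h, x = qh h)).
(* The subalgebra of Uneg0 generated by the f_il and the K_i^{+-1} *)
Definition Uneg0K : Uhat -> Prop :=
  subalg (fun x => (exists i l, in_Iinf (i, l) /\ x = f_ i l) \/
                   (exists i, x = K_ i \/ x = Kinv_ i)).

Record is_comultiplication (Delta : Uhat -> tensor Uhat Uhat) : Prop := {
  comult_hom : alg_hom Delta;
  comult_qh : forall h, Delta (qh h) = pure (qh h) (qh h);
  comult_e : forall i l, in_Iinf (i, l) ->
    Delta (e_ i l) =
    \sum_(0 <= m < l.+1) (qp i ^+ (m * (l - m))) **: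
      pure (e_ i m) (Kinv_ i ^+ m * e_ i (l - m));
  comult_f : forall i l, in_Iinf (i, l) ->
    Delta (f_ i l) =
    \sum_(0 <= m < l.+1) (qp i ^- (m * (l - m))) **:
      pure (f_ i m * K_ i ^+ (l - m)) (f_ i (l - m))
}.

Definition F : pzAlgType Qq := free_alg Qq Iinf.
Definition Fgen (i : I) (l : nat) : F := at_ (fun x => free_gen x : F) i l.

(* |f_il| = - l alpha_i *)
Definition wdeg (w : seq Iinf) : root_lattice :=
  \sum_(x <- w) << - ((val x).2)%:Z *g (val x).1 >>.

Definition homogeneous (x : free_alg Qq Iinf) (b : root_lattice) : Prop :=
  forall w : {fmonom Iinf}, w \in msupp x -> wdeg w = b.

(* (x1 (x) x2)(y1 (x) y2) = q^{-(|x2|,|y1|)} x1 y1 (x) x2 y2, where x2 and y1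
   are expanded in words. *)
Definition twist_mul (s t : tensor F F) : tensor F F :=
  tensor_lift (fun x1 x2 : free_alg Qq Iinf =>
    tensor_lift (fun y1 y2 : free_alg Qq Iinf =>
      \sum_(u <- msupp x2) \sum_(v <- msupp y1)
        (x2@_u * y1@_v * q ^ (- root_form (wdeg u) (wdeg v))) **:
          pure ((x1 : F) * (<< v >> : free_alg Qq Iinf))
               ((<< u >> : free_alg Qq Iinf) * (y2 : F))) t) s.

Definition delta_gen (x : Iinf) : tensor F F :=
  let: (i, l) := val x in
  \sum_(0 <= m < l.+1) (qp i ^- (m * (l - m))) **:
    pure (Fgen i m) (Fgen i (l - m)).

(* The algebra map from the free algebra F to F (x) F with the twisted
   product. *)
Definition delta (x : free_alg Qq Iinf) : tensor F F :=
  \sum_(w <- msupp x) x@_w **: foldr twist_mul 1 [seq delta_gen t | t <- w].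

Record is_lusztig_form (nu : I -> nat -> Qq) (L : F -> F -> Qq) : Prop := {
  lusztig_bilin : bilin_form L;
  lusztig_sym : forall x y, L x y = L y x;
  lusztig_deg : forall x y b c, homogeneous x b -> homogeneous y c ->
    b <> c -> L x y = 0;
  lusztig_one : L 1 1 = 1;
  lusztig_gen : forall i l, in_Iinf (i, l) ->
    L (Fgen i l) (Fgen i l) = nu i l;
  lusztig_mul : forall x y z,
    L x (y * z) = tensor_lift (fun x1 x2 => L x1 y * L x2 z) (delta x)
}.

Definition F_to_Uhat : F -> Uhat :=
  free_lift (fun x : Iinf => quot_pi (gen_f x) : Uhat).

(* The extension of the form LF to Uhat. Its values on the torus are only
   prescribed on pairs (q^h, K_j); a pair (q^h, q^h') with neither h nor h' in
   the span of the r_j h_j may have no admissible value in Q(q): for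
   K_j = (q^{h_j})^{r_j}, compatibility would require
   (q^h, q^{h_j}) ^ r_j = q^{- alpha_j(h)}. The compatibility with Delta is
   therefore required when all the pairings that occur in it have at least one
   argument in Uneg0K. *)
Record is_form_extension (Delta : Uhat -> tensor Uhat Uhat)
    (LF : F -> F -> Qq) (L : Uhat -> Uhat -> Qq) : Prop := {
  form_bilin : bilin_form L;
  form_sym : forall x y, L x y = L y x;
  form_extends : forall x y, L (F_to_Uhat x) (F_to_Uhat y) = LF x y;
  form_qh_one : forall h, L (qh h) 1 = 1;
  form_qh_f : forall h i l, in_Iinf (i, l) -> L (qh h) (f_ i l) = 0;
  form_qh_K : forall h j, L (qh h) (K_ j) = q ^ (- alpha j h);
  form_omega : forall x y, Upos x -> Upos y -> L x y = L (omega x) (omega y);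
  form_Delta : forall x y z, Uneg0 x -> Uneg0 y -> Uneg0 z ->
    Uneg0K x \/ (Uneg0K y /\ Uneg0K z) ->
    L x (y * z) = tensor_lift (fun x1 x2 => L x1 y * L x2 z) (Delta x)
}.

Section QuantumBorcherdsBozec.
Variables (Delta : Uhat -> tensor Uhat Uhat) (L : Uhat -> Uhat -> Qq).

(* As in is_form_extension, a or b is taken in Uneg0K so that every value of
   L below is prescribed; the relations for a = f_ik and b = f_jl are
   included. *)
Inductive Utilde_rel : Uhat -> Prop :=
| Utilde_rel_intro a b : Uneg0 a -> Uneg0 b -> Uneg0K a \/ Uneg0K b ->
    Utilde_rel
      (tensor_lift (fun a1 a2 => tensor_lift (fun b1 b2 =>
         L a1 b2 **: (omega b1 * a2)) (Delta b)) (Delta a)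
       - tensor_lift (fun a1 a2 => tensor_lift (fun b1 b2 =>
         L a2 b1 **: (a1 * omega b2)) (Delta b)) (Delta a)).

Definition Utilde : pzAlgType Qq := quot_alg Utilde_rel.
Definition to_Utilde (x : Uhat) : Utilde := quot_pi x.

(* U^- and U^+ are paired by (x, y) |-> (x, omega y)_L, L itself being
   concentrated in equal degrees. The radical is two-sided; Uhat^- -> Utilde^-
   and Uhat^+ -> Utilde^+ are bijective, and the form on Utilde^- x Utilde^+
   is read through them. *)
Inductive radical : Utilde -> Prop :=
| radical_neg x : Uneg x -> (forall y, Upos y -> L x (omega y) = 0) ->
    radical (to_Utilde x)
| radical_pos y : Upos y -> (forall x, Uneg x -> L x (omega y) = 0) ->
    radical (to_Utilde y).

Definition Uq : pzAlgType Qq := quot_alg radical.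
Definition to_Uq (x : Uhat) : Uq := quot_pi (to_Utilde x).

Definition Uq_e (i : I) (l : nat) : Uq := to_Uq (e_ i l).
Definition Uq_f (i : I) (l : nat) : Uq := to_Uq (f_ i l).
Definition Uq_K (i : I) : Uq := to_Uq (K_ i).
Definition Uq_Kinv (i : I) : Uq := to_Uq (Kinv_ i).

End QuantumBorcherdsBozec.

(* The compositions of m of length d are the d-tuples of positive integers,
   necessarily at most m, with sum m. *)
Definition vartheta (nu : I -> nat -> Qq) (i : I) (m : nat) : Qq :=
  \sum_(d < m.+1)
    \sum_(c : d.-tuple 'I_m.+1 |
          all (fun x : 'I_m.+1 => (0 < x)%N) c && (\sum_(x <- c) x == m)%N)
      (-1) ^+ d * \prod_(x <- c) nu i x.

End CartanDatum.

(* Main.v *)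
Require Import Defs.
From mathcomp Require Import all_boot all_order all_algebra.
From mathcomp Require Import finmap boolp.
From mathcomp.multinomials Require Import monalg.
From mathcomp Require Import zify ring.

Set Implicit Arguments.
Unset Strict Implicit.
Unset Printing Implicit Defensive.

Import GRing.Theory Num.Theory.
Local Open Scope ring_scope.

(** Put nu_0 = 1, N(x) = \sum_p nu_p x^p and Theta(x) = \sum_m vartheta_m x^m.
Splitting off the first part of a composition shows that N Theta = 1
([nu1_vartheta]).

The defining relation of the quantum double for a = f_ik and b = f_il involves
only the pairings (f_im K^s, f_ip), which equal nu_m if m = p and vanish
otherwise ([L_fK_f]). Moving every K_i^{+-p} to the left turns it into

  \sum_p nu_p Y^{-p} e_{l-p} f_{k-p} = \sum_p nu_p Y^p f_{k-p} e_{l-p},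

with Y = q_(i)^{k-l} K_i ([double_lhs], [double_rhs]). Since Y depends on k and l
only through k - l, the relations for (k - s, l - s) all have the same Y. With
T the shift s |-> s + 1 acting on the sequences E_s = e_{l-s} f_{k-s} and
F_s = f_{k-s} e_{l-s}, they read N(Y^{-1} T) E = N(Y T) F. Hence
E = Theta(Y^{-1} T) N(Y T) F, and subtracting
F = Theta(Y^{-1} T) N(Y^{-1} T) F gives, at s = 0, the commutation relation
([convolution_inversion]). *)

(** * Tensors, scaling and finite sums *)

Section Bilinear.
Context {K : fieldType}.

Lemma tensor_lift_sum_pure (A B : pzAlgType K) (X : lmodType K)
    (b : A -> B -> X) (n : nat) (c : nat -> K) (x : nat -> A) (y : nat -> B) :
  bilin b ->
  tensor_lift b (\sum_(0 <= m < n) c m **: pure (x m) (y m)) =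
  \sum_(0 <= m < n) c m *: b (x m) (y m).
Proof.
move=> bb.
have lD := tensor_liftD bb; have l0 := tensor_lift0 bb.
rewrite (big_morph (tensor_lift b) lD l0).
apply: eq_bigr => m _.
exact: (etrans (tensor_liftZ bb _ _) (congr1 _ (tensor_lift_pure bb _ _))).
Qed.

Lemma ascale0l (A : pzAlgType K) (x : A) : 0 **: x = 0.
Proof. exact: (@scale0r K (lmod_of A)). Qed.

Lemma ascale_suml (A : pzAlgType K) (J : Type) (s : seq J) (P : pred J)
    (c : J -> K) (x : A) :
  (\sum_(j <- s | P j) c j) **: x = \sum_(j <- s | P j) c j **: x.
Proof. exact: (@scaler_suml K (lmod_of A)). Qed.

Lemma ascale_sumr (A : pzAlgType K) (J : Type) (s : seq J) (P : pred J)
    (c : K) (x : J -> A) :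
  c **: (\sum_(j <- s | P j) x j) = \sum_(j <- s | P j) c **: x j.
Proof. exact: (@scaler_sumr K (lmod_of A)). Qed.

Lemma ascaleXn (A : pzAlgType K) (c : K) (x : A) n :
  (c **: x) ^+ n = (c ^+ n) **: x ^+ n.
Proof.
elim: n => [|n IHn]; first by rewrite !expr0 ascale1.
by rewrite !exprS IHn -ascaleAl -ascaleAr ascaleA.
Qed.

(** A [tensor_lift] is a finite sum of values of the lifted map at pairs that do
not depend on the parameters [x] and [y]. *)
Lemma bilin_lift (A B V W : pzAlgType K) (X : lmodType K)
    (b : V -> W -> A -> B -> X) (t : tensor V W) :
  (forall v w, bilin (b v w)) ->
  bilin (fun x y => tensor_lift (fun v w => b v w x y) t).
Proof.
move=> bb; split=> c v v' w; rewrite /tensor_lift /pairs_eval scaler_sumr;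
  rewrite -big_split /=; apply: eq_bigr => p _.
  by have [-> _] := bb p.1 p.2.
by have [_ ->] := bb p.1 p.2.
Qed.

Lemma bilin_scale (A B D : pzAlgType K) (u : A -> K) (g : B -> D) :
  (forall c x y, u (c **: x + y) = c * u x + u y) ->
  (forall c x y, g (c **: x + y) = c **: g x + g y) ->
  @bilin K A B (lmod_of D) (fun x y => u x **: g y).
Proof.
move=> ul gl; split=> c v v' w.
  rewrite ul ascaleDl -ascaleA; reflexivity.
rewrite gl ascaleDr ascaleA mulrC -ascaleA; reflexivity.
Qed.

Lemma bilin_scaleC (A B D : pzAlgType K) (u : B -> K) (g : A -> D) :
  (forall c x y, u (c **: x + y) = c * u x + u y) ->
  (forall c x y, g (c **: x + y) = c **: g x + g y) ->
  @bilin K A B (lmod_of D) (fun x y => u y **: g x).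
Proof. by move=> ul gl; have [gr gs] := bilin_scale ul gl; split. Qed.

End Bilinear.

Lemma sum_nat_diag (V : nmodType) (k l : nat) (G : nat -> V) :
  \sum_(0 <= m < k.+1) \sum_(0 <= n < l.+1) (if m == n then G m else 0) =
  \sum_(0 <= p < (minn k l).+1) G p.
Proof.
transitivity (\sum_(0 <= m < k.+1 | (m < l.+1)%N) G m).
  rewrite [RHS]big_mkcond /=; apply: eq_bigr => m _.
  rewrite big_mkord -big_mkcond /=.
  case: ltnP => ml; last first.
    by rewrite big1 // => n /eqP mn; move: (ltn_ord n); rewrite -mn ltnNge ml.
  by rewrite (big_pred1 (Ordinal ml)) // => n; rewrite -val_eqE eq_sym.
rewrite !big_mkord (@big_ord_widen _ _ _ _ k.+1 G) ?ltnS ?geq_minl //.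
apply: eq_bigl => m; have mk : (m <= k)%N by rewrite -ltnS ltn_ord.
by rewrite !ltnS leq_min mk.
Qed.

Lemma sum_nat_triangle (V : nmodType) (n : nat) (G : nat -> nat -> V) :
  \sum_(0 <= s < n.+1) \sum_(0 <= p < (n - s).+1) G s p =
  \sum_(0 <= j < n.+1) \sum_(0 <= p < j.+1) G (j - p)%N p.
Proof.
elim: n => [|n IHn]; first by rewrite !big_nat1.
rewrite big_nat_recr //= [RHS]big_nat_recr //= -IHn subnn big_nat1.
under eq_big_nat => s sn do rewrite subSn // big_nat_recr //=.
rewrite big_split /= -addrA; congr (_ + _).
rewrite [RHS]big_nat_rev [RHS]big_nat_recr //= add0n !subSS subnn subn0.
congr (_ + _); apply: eq_big_nat => p /= pn.
by rewrite !subSS subKn ?subSn // ltnW.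
Qed.

(** * Sums over compositions *)

Section Compositions.
Context {I : countType} (nu : I -> nat -> Qq) (i : I).

(** The sum of the products of [nu] over the compositions of [m] into [d] parts,
by recursion on the first part. This form, unlike the sum over tuples of
ordinals in [vartheta], has no bound on the parts tied to [m]. *)
Fixpoint comp_sum (d m : nat) : Qq :=
  if d is d'.+1 then \sum_(1 <= r < m.+1) nu i r * comp_sum d' (m - r)
  else (m == 0%N)%:R.

(** The bound [M] on the entries is kept independent of [m] because the induction
removes the first part and so lowers [m] alone. *)
Lemma comp_sum_tuples (M d m : nat) : (m <= M)%N ->
  comp_sum d m =
  \sum_(c : d.-tuple 'I_M.+1 |
        all (fun x : 'I_M.+1 => (0 < x)%N) c && (\sum_(x <- c) x == m)%N)
    \prod_(x <- c) nu i x.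
Proof.
elim: d m => [|d IHd] m mM /=.
  rewrite big_mkcond (big_pred1 [tuple]) /=; last first.
    by move=> t; rewrite [t]tuple0 /= eqxx.
  by rewrite !big_nil eq_sym; case: eqP.
pose cons_pair (p : 'I_M.+1 * d.-tuple 'I_M.+1) := [tuple of p.1 :: p.2].
rewrite (reindex cons_pair) /=; last first.
  exists (fun t : d.+1.-tuple 'I_M.+1 => (thead t, [tuple of behead t])).
    by move=> [x t] _; rewrite /cons_pair /= theadE; congr (_, _); apply: val_inj.
  by move=> t _; rewrite /cons_pair /= -tuple_eta.
transitivity (\sum_(x : 'I_M.+1 | (0 < x)%N && (x < m.+1)%N)
    \sum_(t : d.-tuple 'I_M.+1 |
           all (fun y : 'I_M.+1 => (0 < y)%N) t && (\sum_(y <- t) y == m - x)%N)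
      nu i x * \prod_(y <- t) nu i y).
  rewrite big_geq_mkord (big_ord_widen_cond M.+1 _
    (fun r => nu i r * comp_sum d (m - r))) //=.
  apply: eq_bigr => x _; rewrite IHd ?mulr_sumr //.
  exact: leq_trans (leq_subr _ _) mM.
rewrite pair_big_dep /=; apply: eq_big => [[x t]|[x t] _] /=.
  rewrite big_cons -[RHS]andbA -[LHS]andbA; congr (_ && _).
  rewrite [LHS]andbCA; congr (_ && _).
  by set s := (\sum_(y <- t) y)%N; rewrite ltnS; apply/andP/eqP => [[]|]; lia.
by rewrite big_cons.
Qed.

Lemma comp_sum_gt (d m : nat) : (m < d)%N -> comp_sum d m = 0.
Proof.
elim: d m => [//|d IHd] m md /=; rewrite big_nat big1 // => r /andP[r0 rm].
by rewrite IHd ?mulr0 //; lia.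
Qed.

(** A composition of [m] has at most [m] parts, so any longer range of lengths
adds zero terms; a range common to all [m - r] is what allows the exchange of
sums in [varthetaS]. *)
Lemma vartheta_comp_sum (D m : nat) : (m < D)%N ->
  vartheta nu i m = \sum_(0 <= d < D) (-1) ^+ d * comp_sum d m.
Proof.
move=> mD; rewrite (@big_cat_nat _ _ _ m.+1) //= [X in _ + X]big_nat.
rewrite [X in _ + X]big1 ?addr0 => [|d /andP[md _]]; last first.
  by rewrite comp_sum_gt ?mulr0.
rewrite /vartheta big_mkord; apply: eq_bigr => d _.
by rewrite (comp_sum_tuples _ (leqnn m)) mulr_sumr.
Qed.

Lemma vartheta0 : vartheta nu i 0 = 1.
Proof. by rewrite (vartheta_comp_sum (leqnn 1)) big_nat1 mulr1. Qed.

Lemma varthetaS (m : nat) : (0 < m)%N ->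
  vartheta nu i m = - \sum_(1 <= r < m.+1) nu i r * vartheta nu i (m - r).
Proof.
case: m => [//|m] _; rewrite (vartheta_comp_sum (leqnn _)) big_nat_recl //=.
rewrite mulr0 add0r -sumrN.
under eq_bigr do rewrite exprS mulN1r mulNr mulr_sumr.
rewrite sumrN sumrN; congr (- _); rewrite exchange_big big_nat [RHS]big_nat /=.
apply: eq_bigr => r /andP[r0 rm]; rewrite (@vartheta_comp_sum m.+1); last by lia.
by rewrite mulr_sumr; apply: eq_bigr => d _; rewrite mulrCA.
Qed.
End Compositions.

(** The coefficients of the power series N: the value [nu i 0] is unconstrained,
whereas f_i0 = 1 pairs to 1 with itself. *)
Definition nu1 {I : countType} (nu : I -> nat -> Qq) (i : I) (l : nat) : Qq :=
  if l == 0%N then 1 else nu i l.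

Lemma nu1_vartheta {I : countType} (nu : I -> nat -> Qq) (i : I) (m : nat) :
  \sum_(0 <= r < m.+1) nu1 nu i r * vartheta nu i (m - r) = (m == 0%N)%:R.
Proof.
case: m => [|m]; first by rewrite big_nat1 vartheta0 mulr1.
rewrite big_nat_recl // subn0 /nu1 eqxx mul1r [X in X + _]varthetaS //.
by rewrite [X in - X + _]big_add1 /= addNr.
Qed.

(** * Inversion of a convolution relation *)

Section Inversion.
Context {I : countType} (nu : I -> nat -> Qq) (i : I) {A : pzAlgType Qq}.
(** The relations form a unitriangular system for [E], whose inverse has
coefficients [vartheta nu i s **: Yinv ^+ s]. Applied to the right-hand sides
with [Yinv] in place of [Y], the same inverse returns [F]; the terms with
[r = 0] cancel in the difference of the two expressions. *)
Lemma convolution_inversion (Y Yinv : A) (E F : nat -> A) (n : nat) :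
  (forall s, (s <= n)%N ->
     \sum_(0 <= p < (n - s).+1) nu1 nu i p **: (Yinv ^+ p * E (s + p)%N) =
     \sum_(0 <= p < (n - s).+1) nu1 nu i p **: (Y ^+ p * F (s + p)%N)) ->
  E 0%N - F 0%N =
  \sum_(1 <= p < n.+1)
    (\sum_(1 <= r < p.+1) (nu i r * vartheta nu i (p - r)) **:
       (Yinv ^+ (p - r) * (Y ^+ r - Yinv ^+ r))) * F p.
Proof.
move=> EF.
(* S Z H is the combination, with the coefficients of the inverse system, of
   the sums occurring in the hypothesis. *)
pose S (Z : A) (H : nat -> A) := \sum_(0 <= s < n.+1)
  (vartheta nu i s **: Yinv ^+ s) *
  \sum_(0 <= p < (n - s).+1) nu1 nu i p **: (Z ^+ p * H (s + p)%N).
have SE Z H : S Z H = \sum_(0 <= j < n.+1) (\sum_(0 <= r < j.+1)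
    (nu1 nu i r * vartheta nu i (j - r)) **: (Yinv ^+ (j - r) * Z ^+ r)) * H j.
  rewrite /S; under eq_bigr do rewrite mulr_sumr.
  rewrite sum_nat_triangle; apply: eq_bigr => j _; rewrite mulr_suml.
  apply: eq_big_nat => r /andP[_ rj].
  by rewrite subnK // -ascaleAr -!ascaleAl ascaleA mulrA.
(* For Z = Yinv the powers combine to Yinv ^+ j and the scalars to a
   coefficient of N Theta = 1. *)
have S0 H : S Yinv H = H 0%N.
  rewrite SE big_nat_recl // big_nat1 vartheta0 /nu1 eqxx mulr1 ascale1 !mul1r.
  rewrite big1 ?addr0 // => j _.
  rewrite (_ : \sum_(_ <= _ < _) _ = 0) ?mul0r //.
  under eq_big_nat => r rj do rewrite -exprD subnK //.
  by rewrite -ascale_suml nu1_vartheta ascale0l.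
have SYF : S Yinv E = S Y F.
  by apply: eq_big_nat => s sn; rewrite EF.
rewrite -S0 SYF -(S0 F) !SE -sumrB big_nat_recl // !big_nat1 !expr0 subrr add0r.
rewrite [RHS]big_add1 /=; apply: eq_bigr => j _; rewrite -mulrBl -sumrB.
congr (_ * _); rewrite [LHS]big_nat_recl //= !expr0 subrr add0r [RHS]big_add1 /=.
by apply: eq_bigr => r _; rewrite -ascaleBr -mulrBr.
Qed.
End Inversion.

(** * The torus action *)

Lemma q_neq0 : q != 0.
Proof. by rewrite tofrac_eq0 polyX_eq0. Qed.

Section Torus.
Context {I : countType} (C : cartan_datum I).
Implicit Types i j : I.

Lemma in_Iinf_im i m : is_im C i -> (0 < m)%N -> in_Iinf C (i, m).
Proof. by move=> im_i m0; rewrite /in_Iinf /= im_i m0 orbT. Qed.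

Lemma qp_neq0 i : qp C i != 0.
Proof. exact: expfz_neq0 q_neq0. Qed.

(** The scalar in front of K_i^{+-m} once it has been moved to the left: the
first two factors come from the two comultiplications, the third from the
commutation with a generator of index [b]. *)
Lemma qp_coef i (a b m : nat) :
  qp C i ^- (m * a) * qp C i ^- (m * b) * qp C i ^+ (2 * b * m) =
  (qp C i ^ (b%:Z - a%:Z)) ^+ m.
Proof.
have t0 := qp_neq0 i; rewrite !exprnN !exprnP -!expfzDr // exprz_exp.
by congr (_ ^ _); rewrite !PoszM; ring.
Qed.

Lemma alpha_hr i j n : alpha C j (h_ i *+ n) = n%:Z * cartan_a C i j.
Proof.
have -> : h_ i *+ n = << n%:Z *g inl i >> :> @coweight I.
  apply/malgP => x; rewrite mcoeffMn /h_ !mcoeffU.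
  by case: eqP => _; rewrite ?mulr1n ?natz // !mulr0n mul0rn.
rewrite /alpha.
have [->|n0] := eqVneq n 0%N.
  by rewrite mul0r big1 // => x _; rewrite mcoeffU mul0rn mul0r.
by rewrite msuppU eqz_nat (negPf n0) big_seq_fset1 mcoeffUU.
Qed.

(** The diagonal entries of the Cartan matrix are even, so q_(i) is an integral
power of q and its square is q^(alpha_i, alpha_i). *)
Lemma qpE i (m : int) :
  q ^ (m * alpha C i (h_ i *+ cartan_r C i)) = qp C i ^ (2 * m).
Proof.
rewrite alpha_hr /qp exprz_exp; congr (q ^ _).
have [n ->] := cartan_diag C i.
have -> : (cartan_r C i)%:Z * (2 - n.*2%:Z) = (cartan_r C i)%:Z * (1 - n%:Z) * 2.
  by lia.
by rewrite mulzK //; lia.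
Qed.

Lemma Kinv_K i : Kinv_ C i * K_ C i = 1.
Proof. by rewrite -qhD addNr qh0. Qed.

Lemma e_Kinv i m : in_Iinf C (i, m) ->
  e_ C i m * Kinv_ C i = (qp C i ^+ (2 * m)) **: (Kinv_ C i * e_ C i m).
Proof.
move=> im; have := qh_e (h_ i *+ cartan_r C i) im.
rewrite qpE -/(K_ C i) -/(Kinv_ C i) => H.
by rewrite -[LHS]mul1r -(Kinv_K i) -!mulrA [X in _ * X]mulrA H -ascaleAr.
Qed.

Lemma f_K i m : in_Iinf C (i, m) ->
  f_ C i m * K_ C i = (qp C i ^+ (2 * m)) **: (K_ C i * f_ C i m).
Proof.
move=> im; have := qh_f (h_ i *+ cartan_r C i) im.
rewrite -mulNr qpE -/(K_ C i) -/(Kinv_ C i) => H.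
rewrite -[K_ C i * f_ C i m]mulr1 -(Kinv_K i) !mulrA H -ascaleAl ascaleA.
by rewrite exprnP -expfzDr ?qp_neq0 // mulrN PoszM subrr ascale1.
Qed.

Lemma scaled_commX (A : pzAlgType Qq) (c : Qq) (x y : A) p :
  x * y = c **: (y * x) -> x * y ^+ p = (c ^+ p) **: (y ^+ p * x).
Proof.
move=> xy; elim: p => [|p IHp]; first by rewrite !expr0 mulr1 mul1r ascale1.
rewrite !exprSr mulrA IHp -ascaleAl -[y ^+ p * x * y]mulrA xy.
by rewrite -ascaleAr ascaleA mulrA.
Qed.

Lemma e_KinvX i m p : is_im C i ->
  e_ C i m * Kinv_ C i ^+ p =
  (qp C i ^+ (2 * m * p)) **: (Kinv_ C i ^+ p * e_ C i m).
Proof.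
move=> im_i; case: m => [|m].
  by rewrite /e_ /at_ eqxx muln0 mul0n ascale1 mul1r mulr1.
by rewrite exprM; apply/scaled_commX/e_Kinv/in_Iinf_im.
Qed.

Lemma f_KX i m p : is_im C i ->
  f_ C i m * K_ C i ^+ p =
  (qp C i ^+ (2 * m * p)) **: (K_ C i ^+ p * f_ C i m).
Proof.
move=> im_i; case: m => [|m].
  by rewrite /f_ /at_ eqxx muln0 mul0n ascale1 mul1r mulr1.
by rewrite exprM; apply/scaled_commX/f_K/in_Iinf_im.
Qed.
End Torus.

(** * The relation of the double for f_ik and f_il *)

Section Pairing.
Context {I : countType} {C : cartan_datum I} {nu : I -> nat -> Qq}.
Context {Delta : Uhat C -> tensor (Uhat C) (Uhat C)}
        (Delta_comult : is_comultiplication Delta)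
        {LF : F C -> F C -> Qq} (LF_form : is_lusztig_form nu LF)
        {L : Uhat C -> Uhat C -> Qq} (L_ext : is_form_extension Delta LF L).
Context (i : I) (i_im : is_im C i).

Local Notation f := (f_ C i).
Local Notation e := (e_ C i).
Local Notation K := (K_ C i).
Local Notation Kinv := (Kinv_ C i).
Local Notation t := (qp C i).

Lemma Delta_f l : Delta (f l) =
  \sum_(0 <= m < l.+1) (t ^- (m * (l - m))) **:
    pure (f m * K ^+ (l - m)) (f (l - m)%N).
Proof.
case: l => [|l]; last exact/comult_f/in_Iinf_im.
rewrite big_nat1 /f_ /at_ /= mulr1 expr0 invr1 ascale1.
exact: alg_hom1 (comult_hom Delta_comult).
Qed.

Lemma F_to_Uhat_gen m : F_to_Uhat (Fgen C i m) = f m.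
Proof.
rewrite /F_to_Uhat /Fgen (at_hom _ _ _ (free_lift_hom _)).
by congr at_; apply/funext => u; rewrite free_lift_gen.
Qed.

Lemma Fgen_homogeneous m :
  homogeneous (Fgen C i m) (<< - m%:Z *g i >> : @root_lattice I).
Proof.
case: m => [|m] w.
  rewrite /Fgen /at_ /= -mcoeff_neq0 mcoeff1.
  case: (w =P _) => [-> _|_]; last by rewrite eqxx.
  by rewrite /wdeg fm1 big_nil; apply/malgP => x; rewrite mcoeff0 mcoeffU mul0rn.
rewrite /Fgen /at_ /= (insubT _ (in_Iinf_im i_im (ltn0Sn m))).
rewrite free_gen.unlock msuppU1 inE => /eqP ->.
by rewrite /wdeg fmU big_seq1.
Qed.

Lemma L_ff m p : L (f m) (f p) = if m == p then nu1 nu i m else 0.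
Proof.
rewrite -!F_to_Uhat_gen (form_extends L_ext); case: eqP => [<-|ne]; last first.
  apply: (lusztig_deg LF_form); [exact: Fgen_homogeneous| |].
    exact: Fgen_homogeneous.
  move=> /malgP /(_ i); rewrite !mcoeffUU => /eqP; rewrite eqr_opp eqz_nat.
  by move/eqP.
case: m => [|m]; first exact: lusztig_one LF_form.
exact/(lusztig_gen LF_form)/in_Iinf_im.
Qed.

Lemma KX s : K ^+ s = qh C (h_ i *+ cartan_r C i *+ s).
Proof.
elim: s => [|s IHs]; first by rewrite mulr0n qh0.
by rewrite exprSr IHs -qhD -mulrSr.
Qed.

Lemma Uneg0_f m : Uneg0 (f m).
Proof.
case: m => [|m]; first exact: subalg_one.
by apply: subalg_gen; left; exists i, m.+1; split=> //; apply: in_Iinf_im.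
Qed.

Lemma Uneg0K_f m : Uneg0K (f m).
Proof.
case: m => [|m]; first exact: subalg_one.
by apply: subalg_gen; left; exists i, m.+1; split=> //; apply: in_Iinf_im.
Qed.

Lemma Uneg0_KX s : Uneg0 (K ^+ s).
Proof. by rewrite KX; apply: subalg_gen; right; eexists. Qed.

(** By symmetry, [f m * K ^+ s] may be placed on the right, where compatibility
with [Delta] splits the product. Since a power of [K] is orthogonal to every
f_in with n > 0, only the term f_ip (x) 1 of [Delta (f p)] survives. *)
Lemma L_fK_f m s p : L (f m * K ^+ s) (f p) = if m == p then nu1 nu i m else 0.
Proof.
rewrite (form_sym L_ext) (form_Delta L_ext (Uneg0_f p) (Uneg0_f m) (Uneg0_KX s)
  (or_introl (Uneg0K_f p))).
have [Ll Lr] := form_bilin L_ext.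
rewrite Delta_f (@tensor_lift_sum_pure _ _ _ Qq^o); last first.
  split=> c v v' w; first by rewrite Ll mulrDl scalerAl.
  by rewrite Ll mulrDr scalerAr.
rewrite big_nat_recr //= subnn muln0 expr0 invr1 scale1r mulr1 L_ff.
rewrite [f 0]/(1 : Uhat C) (form_sym L_ext 1) KX (form_qh_one L_ext) mulr1.
rewrite big1_seq ?add0r; first by case: eqVneq => [->|].
move=> n /=; rewrite mem_index_iota => np.
by rewrite (form_sym L_ext _ (qh _ _)) (form_qh_f L_ext) ?mulr0 ?scaler0 //;
   apply: in_Iinf_im => //; lia.
Qed.

Lemma omega_fK n s : omega (f n * K ^+ s) = e n * Kinv ^+ s.
Proof.
rewrite (alg_homM (omega_hom C)) (alg_homX (omega_hom C)).
by rewrite omega_f omega_qh.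
Qed.

Lemma tensor_lift_Delta_f (D : pzAlgType Qq) (b : Uhat C -> Uhat C -> D) m :
  @bilin _ _ _ (lmod_of D) b ->
  tensor_lift b (Delta (f m)) =
  \sum_(0 <= n < m.+1)
    (t ^- (n * (m - n))) **: b (f n * K ^+ (m - n)) (f (m - n)%N).
Proof.
by move=> bb; rewrite Delta_f; apply: (@tensor_lift_sum_pure _ _ _ (lmod_of D)).
Qed.

Lemma omega_lin c (x y : Uhat C) : omega (c **: x + y) = c **: omega x + omega y.
Proof. by have [_ _ ->] := omega_hom C. Qed.

Lemma L_linl z c x y : L (c **: x + y) z = c * L x z + L y z.
Proof. by have [-> _] := form_bilin L_ext. Qed.

Lemma L_linr z c x y : L z (c **: x + y) = c * L z x + L z y.
Proof. by have [_ ->] := form_bilin L_ext. Qed.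

Lemma mulr_lin (A : pzAlgType Qq) (z : A) c x y :
  z * (c **: x + y) = c **: (z * x) + z * y.
Proof. by rewrite mulrDr ascaleAr. Qed.

Lemma mull_lin (A : pzAlgType Qq) (z : A) c x y :
  (c **: x + y) * z = c **: (x * z) + y * z.
Proof. by rewrite mulrDl ascaleAl. Qed.

(** Orthogonality leaves the pairs of terms of [Delta (f k)] and [Delta (f l)] in
which the two paired factors have the same index [p]; on this side they
contribute e_{l-p} K_i^{-p} f_{k-p}. *)
Lemma double_lhs k l :
  tensor_lift (fun a1 a2 => tensor_lift (fun b1 b2 =>
     L a1 b2 **: (omega b1 * a2)) (Delta (f l))) (Delta (f k)) =
  \sum_(0 <= p < (minn k l).+1)
    nu1 nu i p **: (((t ^ (l%:Z - k%:Z)) **: Kinv) ^+ p *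
                    (e (l - p) * f (k - p))).
Proof.
rewrite (@tensor_lift_Delta_f _ _ k); last first.
  apply: bilin_lift => b1 b2; apply: bilin_scale => *; first exact: L_linl.
  exact: mulr_lin.
rewrite -sum_nat_diag; apply: eq_big_nat => m /= mk.
rewrite (@tensor_lift_Delta_f _ _ l); last first.
  apply: bilin_scaleC => *; first exact: L_linr.
  by rewrite omega_lin mull_lin.
rewrite big_nat_rev ascale_sumr /=; apply: eq_big_nat => n /= nl.
rewrite add0n subSS subKn // L_fK_f omega_fK; case: eqVneq => [mn|_]; last first.
  by rewrite ascale0l !ascaler0.
subst m; rewrite e_KinvX // -ascaleAl !ascaleA ascaleXn -ascaleAl ascaleA mulrA.
congr (_ **: _).
have -> : l%:Z - k%:Z = (l - n)%:Z - (k - n)%:Z by lia.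
by rewrite -qp_coef [((l - n) * n)%N]mulnC; ring.
Qed.

(** Here the surviving terms are f_{k-p} K_i^p e_{l-p}: the paired factors are
the second one of [Delta (f k)] and the first one of [Delta (f l)]. *)
Lemma double_rhs k l :
  tensor_lift (fun a1 a2 => tensor_lift (fun b1 b2 =>
     L a2 b1 **: (a1 * omega b2)) (Delta (f l))) (Delta (f k)) =
  \sum_(0 <= p < (minn k l).+1)
    nu1 nu i p **: (((t ^ (k%:Z - l%:Z)) **: K) ^+ p *
                    (f (k - p) * e (l - p))).
Proof.
rewrite (@tensor_lift_Delta_f _ _ k); last first.
  apply: bilin_lift => b1 b2; apply: bilin_scaleC => *; first exact: L_linl.
  exact: mull_lin.
rewrite -sum_nat_diag big_nat_rev /=; apply: eq_big_nat => m /= mk.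
rewrite add0n subSS subKn //.
rewrite (@tensor_lift_Delta_f _ _ l); last first.
  apply: bilin_scale => *; first exact: L_linr.
  by rewrite omega_lin mulr_lin.
rewrite ascale_sumr /=; apply: eq_big_nat => n /= nl.
rewrite (form_sym L_ext) L_fK_f omega_f eq_sym; case: eqVneq => [mn|_]; last first.
  by rewrite ascale0l !ascaler0.
subst m; rewrite f_KX // -ascaleAl !ascaleA ascaleXn -ascaleAl ascaleA mulrA.
congr (_ **: _).
have -> : k%:Z - l%:Z = (k - n)%:Z - (l - n)%:Z by lia.
by rewrite -qp_coef [((k - n) * n)%N]mulnC; ring.
Qed.

End Pairing.

(** * The commutation relation *)

Section QuantumGroup.
Context {I : countType} {C : cartan_datum I}.
Context (Delta : Uhat C -> tensor (Uhat C) (Uhat C))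
        (L : Uhat C -> Uhat C -> Qq).

Lemma to_Uq_hom : alg_hom (to_Uq Delta L).
Proof.
have pH := quot_pi_hom (Utilde_rel Delta L).
have rH := quot_pi_hom (@radical I C Delta L).
split=> [|x y|c x y]; rewrite /to_Uq /to_Utilde.
- by rewrite (alg_hom1 pH) (alg_hom1 rH).
- by rewrite (alg_homM pH) (alg_homM rH).
- by have [_ _ ->] := pH; have [_ _ ->] := rH.
Qed.

Lemma to_Uq_rel x y :
  Utilde_rel Delta L (x - y) -> to_Uq Delta L x = to_Uq Delta L y.
Proof. by move=> xy; congr quot_pi; apply/quot_piP/ideal_gen_base. Qed.
End QuantumGroup.

Theorem propositionA2 (I : countType) (C : cartan_datum I)
    (nu : I -> nat -> Qq)
    (nu_neq0 : forall i l, in_Iinf C (i, l) -> nu i l != 0)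
    (nu_pos : forall i l, in_Iinf C (i, l) -> in_one_plus_qNq (nu i l))
    (Delta : Uhat C -> tensor (Uhat C) (Uhat C))
    (Delta_comult : is_comultiplication Delta)
    (LF : F C -> F C -> Qq) (LF_form : is_lusztig_form nu LF)
    (L : Uhat C -> Uhat C -> Qq) (L_ext : is_form_extension Delta LF L)
    (i : I) (i_im : is_im C i) (k l : nat) (k_gt0 : (0 < k)%N)
    (l_gt0 : (0 < l)%N) :
  let e := Uq_e Delta L i in
  let f := Uq_f Delta L i in
  let Y : Uq Delta L := (qp C i ^ (k%:Z - l%:Z)) **: Uq_K Delta L i in
  let Yinv : Uq Delta L :=
    (qp C i ^ (l%:Z - k%:Z)) **: Uq_Kinv Delta L i in
  e l * f k - f k * e l =
  \sum_(1 <= p < (minn k l).+1)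
    (\sum_(1 <= r < p.+1)
       (nu i r * vartheta nu i (p - r)) **:
         (Yinv ^+ (p - r) * (Y ^+ r - Yinv ^+ r)))
    * f (k - p)%N * e (l - p)%N.
Proof.
move=> e f Y Yinv.
have toH := to_Uq_hom Delta L.
pose E s := e (l - s)%N * f (k - s)%N; pose F s := f (k - s)%N * e (l - s)%N.
have EF s : (s <= minn k l)%N ->
   \sum_(0 <= p < (minn k l - s).+1) nu1 nu i p **: (Yinv ^+ p * E (s + p)%N) =
   \sum_(0 <= p < (minn k l - s).+1) nu1 nu i p **: (Y ^+ p * F (s + p)%N).
  (* The relation of the double for f_{i,k-s} and f_{i,l-s}: its Y is that of
     k and l because (k - s) - (l - s) = k - l. *)
  rewrite leq_min => /andP[sk sl].
  have : Utilde_rel Delta L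
     (\sum_(0 <= p < (minn (k - s) (l - s)).+1) nu1 nu i p **:
        (((qp C i ^ ((l - s)%:Z - (k - s)%:Z)) **: Kinv_ C i) ^+ p *
          (e_ C i (l - s - p) * f_ C i (k - s - p))) -
      \sum_(0 <= p < (minn (k - s) (l - s)).+1) nu1 nu i p **:
        (((qp C i ^ ((k - s)%:Z - (l - s)%:Z)) **: K_ C i) ^+ p *
          (f_ C i (k - s - p) * e_ C i (l - s - p)))).
    rewrite -(double_lhs Delta_comult LF_form L_ext i_im).
    rewrite -(double_rhs Delta_comult LF_form L_ext i_im).
    apply: Utilde_rel_intro; [exact: Uneg0_f|exact: Uneg0_f|].
    by left; apply: Uneg0K_f.
  move=> /to_Uq_rel.
  have -> : (l - s)%:Z - (k - s)%:Z = l%:Z - k%:Z by lia.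
  have -> : (k - s)%:Z - (l - s)%:Z = k%:Z - l%:Z by lia.
  have -> : minn (k - s) (l - s) = (minn k l - s)%N by lia.
  rewrite !(alg_hom_sum toH) => H.
  transitivity (\sum_(0 <= p < (minn k l - s).+1) to_Uq Delta L (nu1 nu i p **:
        (((qp C i ^ (l%:Z - k%:Z)) **: Kinv_ C i) ^+ p *
          (e_ C i (l - s - p) * f_ C i (k - s - p))))).
    apply: eq_bigr => p _.
    rewrite (alg_homZ toH) !(alg_homM toH) (alg_homX toH) (alg_homZ toH).
    by rewrite /E !subnDA.
  rewrite H; apply: eq_bigr => p _.
  rewrite (alg_homZ toH) !(alg_homM toH) (alg_homX toH) (alg_homZ toH).
  by rewrite /F !subnDA.
have := convolution_inversion EF.
rewrite /E /F !subn0 => ->.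
by apply: eq_bigr => p _; rewrite mulrA.
Qed.
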